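(* Let $\mathcal L$ be a symmetric implication algebra. Then there is a locally symmetric implication algebra $\operatorname{env}(\mathcal L)$ and an embedding $e\colon\mathcal L\to\operatorname{env}(\mathcal L)$ of symmetric implication algebras such that (a) the range of $e$ is upwards-closed and generates $\operatorname{env}(\mathcal L)$ (using caret and $\to$); (b) if $f\colon\mathcal L\to\mathcal M$ is a symmetric implication morphism to a locally symmetric implication algebra $\mathcal M$, then there is a unique extension of $f$ to a symmetric implication morphism $\widehat f\colon\operatorname{env}(\mathcal L)\to\mathcal M$ such that $\widehat f\circ e=f$.
   Context: An implication algebra is a set with a binary operation $\to$ satisfying $(x\to y)\to x=x$, $(x\to y)\to y=(y\to x)\to x$, $x\to(y\to z)=y\to(x\to z)$. Put $1=x\to x$, $x\le y$ iff $x\to y=1$, and $x\vee y=(x\to y)\to y$ (the join). Each interval $[a,1]$ is a Boolean algebra in which the complement of $b\ge a$ is $b\to a$; $\wedge$ denotes greatest lower bounds, when they exist. A symmetric implication algebra is an implication algebra with a distinguished automorphism $T$ of order two (i.e. $T^2=\mathrm{id}$; the identity is allowed). A symmetric implication morphism is a map preserving $\to$ and commuting with $T$. A locally symmetric implication algebra is a symmetric implication algebra in which the meet $x\wedge T(x\to y)$ exists whenever $x\ge y$. In a symmetric implication algebra put $\Delta(b,a)=b\wedge T(b\to a)$ for $a\le b$ (when this meet exists). The caret is the partial operation $x\mathbin{\hat{\ }}y = x\wedge\Delta(x\vee y,y)=x\wedge T(x\to y)$, defined whenever this meet exists. (In a locally symmetric implication algebra it is defined whenever $x\ge y$, where it equals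 $\Delta(x,y)$.) ''Generates using caret and $\to$'' means that no proper subset containing the range of $e$ is closed under $\to$ and under the (defined values of the) caret. *)

(* Defs.v *)
From HB Require Import structures.
From mathcomp Require Import all_boot.

Set Implicit Arguments.
Unset Strict Implicit.
Unset Printing Implicit Defensive.

Reserved Notation "x ~> y" (at level 55, right associativity).

Declare Scope implication_scope.
Delimit Scope implication_scope with impl.

HB.mixin Record isImplicationAlgebra A := {
  imp : A -> A -> A;
  imp_contract : forall x y, imp (imp x y) x = x;
  imp_quasicomm : forall x y, imp (imp x y) y = imp (imp y x) x;
  imp_exchange : forall x y z, imp x (imp y z) = imp y (imp x z)
}.

#[short(type="implicationAlgebraType")]
HB.structure Definition ImplicationAlgebra := { A of isImplicationAlgebra A }.

Notation "x ~> y" := (imp x y) : implication_scope.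
Local Open Scope implication_scope.

Section Order.
Variable A : implicationAlgebraType.
Implicit Types x y z : A.

(* The constant 1 is [x ~> x], for any x; writing it so does not presuppose
   that the algebra is nonempty. *)
Definition ile x y : Prop := x ~> y = x ~> x.

Definition is_meet x y z : Prop :=
  [/\ ile z x, ile z y & forall w, ile w x -> ile w y -> ile w z].

End Order.

(* An involutive map is bijective, so an involutive endomorphism is an
   automorphism with square the identity. *)
HB.mixin Record isSymmetric A of ImplicationAlgebra A := {
  symT : A -> A;
  symT_imp : forall x y : A, symT (x ~> y) = symT x ~> symT y;
  symTK : involutive symT
}.

#[short(type="symmetricImplicationAlgebraType")]
HB.structure Definition SymmetricImplicationAlgebra :=
  { A of ImplicationAlgebra A & isSymmetric A }.

(* The caret is partial: [is_caret x y z] says that [x ^ y] is defined and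
   equal to z.  Since [(x \/ y) ~> y = x ~> y], the meet of x with
   [Delta (x \/ y, y)] is the meet of x with [symT (x ~> y)]. *)
Definition is_caret (A : symmetricImplicationAlgebraType) (x y z : A) : Prop :=
  is_meet x (symT (x ~> y)) z.

HB.mixin Record isLocallySymmetric A of SymmetricImplicationAlgebra A := {
  caret_exists : forall x y : A, ile y x -> exists z : A, is_caret x y z
}.

#[short(type="locallySymmetricImplicationAlgebraType")]
HB.structure Definition LocallySymmetricImplicationAlgebra :=
  { A of SymmetricImplicationAlgebra A & isLocallySymmetric A }.

Definition symmetric_morphism (A B : symmetricImplicationAlgebraType)
    (f : A -> B) : Prop :=
  (forall x y, f (x ~> y) = f x ~> f y) /\ (forall x, f (symT x) = symT (f x)).

Definition symmetric_embedding (A B : symmetricImplicationAlgebraType)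
    (f : A -> B) : Prop :=
  symmetric_morphism f /\ injective f.

Definition range_upclosed (A : Type) (B : implicationAlgebraType)
    (f : A -> B) : Prop :=
  forall a b, ile (f a) b -> exists a', f a' = b.

Definition range_generates (A : Type) (B : symmetricImplicationAlgebraType)
    (f : A -> B) : Prop :=
  forall S : B -> Prop,
    (forall a, S (f a)) ->
    (forall x y, S x -> S y -> S (x ~> y)) ->
    (forall x y z, S x -> S y -> is_caret x y z -> S z) ->
    forall b, S b.

(* Main.v *)
Require Import Defs.
From HB Require Import structures.
From mathcomp Require Import all_boot.
From mathcomp Require Import boolp classical_sets.

(** The envelope is found inside a Boolean algebra.  The homomorphisms from an
    implication algebra to the two-element one (its valuations) separate its
    points (valuation_separates, by Zorn's lemma), so L becomes an algebra of
    boolean functions on its valuations, and T acts on all such functions by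
    precomposition.  Existing meets are pointwise meets (is_meetP).  Every
    identity, order relation or meet can therefore be checked on booleans.

    In the algebra of all functions, env(L) is the set of the Delta(x, y) with
    y <= x in L.  As y is the meet of x and x ~> y, whose join is 1, these are
    the functions p /\ T q where p and q are elements of L with join 1 and a
    common lower bound in L (a lower bound is what makes meets exist in L).  The
    second form is the convenient one: T exchanges p and q, and

      (p /\ T q) ~> (r /\ T s)
        = (p ~> T q ~> r) /\ T (T p ~> q ~> s),

    where the new pair lies above (r, s).  The substantial point is that the
    set is also closed under the caret (enveloped_caret).

    A morphism f from L to M pulls valuations of M back to valuations of L.
    The extension sends the function phi to the element of M whose value at each
    valuation v is phi (v o f): if phi is Delta(x, y), the caret of f x and f y
    is such an element, and separation makes it unique.  Hence the choice of x
    and y is immaterial, and the extension is a morphism because phi |->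
    phi (v o f) respects the operations.  Uniqueness holds since morphisms
    preserve existing meets and L generates env(L) by carets. *)

Set Implicit Arguments.
Unset Strict Implicit.
Unset Printing Implicit Defensive.

Local Open Scope implication_scope.

(** * The implicational calculus *)

Section ImplicationalCalculus.
Variable A : implicationAlgebraType.
Implicit Types x y z a : A.

Lemma imp_idem x y : x ~> x ~> y = x ~> y.
Proof. by rewrite -{1}[x](imp_contract x y) imp_contract. Qed.

Lemma imp_unit_step x y : x ~> x = (x ~> y) ~> (x ~> y).
Proof. by rewrite -{1}[x](imp_contract x y) imp_quasicomm imp_idem. Qed.

(** The term x ~> x does not change when x is replaced by x ~> z, and the
    exchange law turns x ~> y ~> x into y ~> x ~> x. *)
Lemma imp_unit_eq x y : x ~> x = y ~> y.
Proof.
by rewrite (imp_unit_step x (y ~> x)) [x ~> y ~> x]imp_exchange -imp_unit_step.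
Qed.

Lemma unit_imp x y : (x ~> x) ~> y = y.
Proof. by rewrite (imp_unit_eq x y) imp_contract. Qed.

Lemma imp_unit x y : x ~> y ~> y = x ~> x.
Proof. by rewrite (imp_unit_eq y x) imp_idem. Qed.

Lemma imp_weaken x y : ile x (y ~> x).
Proof. by rewrite /ile imp_exchange imp_unit; apply: imp_unit_eq. Qed.

Lemma ile_antisym x y : ile x y -> ile y x -> x = y.
Proof.
by move=> xy yx; have := imp_quasicomm x y; rewrite xy yx !unit_imp.
Qed.

Lemma imp_prefix x y z : ile (y ~> z) ((x ~> y) ~> x ~> z).
Proof.
rewrite /ile imp_exchange [(y ~> z) ~> x ~> z]imp_exchange imp_quasicomm.
rewrite [x ~> (z ~> y) ~> y]imp_exchange imp_weaken; exact: imp_unit_eq.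
Qed.

Lemma imp_suffix x y z : ile (x ~> y) ((y ~> z) ~> x ~> z).
Proof.
by rewrite /ile imp_exchange imp_prefix; apply: imp_unit_eq.
Qed.

Lemma imp_frege x y z : ile (x ~> y ~> z) ((x ~> y) ~> x ~> z).
Proof.
by rewrite imp_exchange -[in X in ile _ X](imp_idem x z); apply: imp_prefix.
Qed.

(** Case analysis: if a follows from x ~> y and also from x, then a holds.  It
    makes a maximal deductive set which omits x contain x ~> y. *)
Lemma imp_case_split x y a : ile ((x ~> y) ~> a) ((x ~> a) ~> a).
Proof.
rewrite imp_quasicomm -[X in ile _ (_ ~> X)](imp_contract x y).
exact: imp_suffix.
Qed.

End ImplicationalCalculus.

(** * Valuations separate points *)

Record valuation (A : implicationAlgebraType) := Valuation {
  valuation_fun :> A -> bool;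
  valuation_imp :
    forall x y, valuation_fun (x ~> y) = (valuation_fun x ==> valuation_fun y)
}.

Lemma valuation_ext (A : implicationAlgebraType) (v w : valuation A) :
  v =1 w -> v = w.
Proof.
case: v w => [v vM] [w wM] /= /funext vw; rewrite vw in vM *.
by congr Valuation; apply: Prop_irrelevance.
Qed.

Definition valuation_comp (A B : implicationAlgebraType) (f : A -> B)
  (fM : forall x y, f (x ~> y) = f x ~> f y) (v : valuation B) :
  valuation A.
Proof.
by refine (@Valuation A (fun x => v (f x)) _) => x y; rewrite fM valuation_imp.
Defined.

Section Separation.
Variable A : implicationAlgebraType.
Implicit Types (x y z a : A) (F : set A).
Local Open Scope classical_set_scope.

Definition deductive F : Prop :=
  (forall x, F (x ~> x)) /\ (forall x y, F x -> F (x ~> y) -> F y).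

Lemma deductive_ile F x y : deductive F -> ile x y -> F x -> F y.
Proof. by move=> [F1 FMP] xy Fx; apply: FMP Fx _; rewrite xy. Qed.

Lemma deductive_adjoin F x : deductive F -> deductive [set z | F (x ~> z)].
Proof.
move=> dF; have [F1 FMP] := dF; split=> [y|y z] /=; first by rewrite imp_unit.
move=> Fxy /(deductive_ile dF (imp_frege x y z)) Fxz; exact: FMP Fxy Fxz.
Qed.

(** Zorn's lemma is applied to the sets which become deductive once 1 is added,
    because the union of the empty chain is empty and so is not deductive. *)
Lemma maximal_deductive a : (exists x, a <> x ~> x) ->
  exists F, [/\ deductive F, ~ F a &
    forall G, deductive G -> F `<=` G -> ~ G a -> G `<=` F].
Proof.
move=> [x0 a1]; pose one := [set x0 ~> x0].
have oneE x : one (x ~> x) by apply: imp_unit_eq.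
pose P F := deductive (F `|` one) /\ ~ (F `|` one) a.
have [|F [[dF Fa] maxF]] := @Zorn_bigcup A P.
  move=> C CP Ctot; split; last first.
    by move=> [[X CX Xa]|//]; have [_] := CP X CX; apply; left.
  split=> [x|x y]; first by right.
  have lift X : C X -> (X `|` one) x -> (X `|` one) (x ~> y) ->
      (\bigcup_(Y in C) Y `|` one) y.
    move=> CX Xx Xxy; have [[_ XMP] _] := CP X CX.
    by case: (XMP _ _ Xx Xxy) => [Xy|]; [left; exists X|right].
  case=> [[X CX Xx]|->]; last by rewrite unit_imp.
  case=> [[Y CY Yxy]|xy1]; last by apply: (lift X CX); [left|right].
  by have [XY|YX] := Ctot X Y CX CY; [apply: (lift Y CY)|apply: (lift X CX)];
    left; auto.
exists (F `|` one); split=> // G dG FG Ga.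
have G1 : one `<=` G by move=> _ ->; case: dG.
have GE : G `|` one = G by apply/setUidPl.
have [GF x Gx|FnG] := pselect (G `<=` F); first by left; apply: GF.
by case: (maxF G); [split=> // x Fx; apply: FG; left|rewrite /P GE].
Qed.

(** The characteristic function of a maximal deductive set F avoiding a is a
    valuation: when x is not in F, the deductive set generated by F and x
    contains a, that is, F contains x ~> a. *)
Lemma valuation_separates a : (exists x, a <> x ~> x) ->
  exists v : valuation A, ~~ v a.
Proof.
move=> /maximal_deductive[F [dF Fa maxF]]; have [F1 FMP] := dF.
have notF x : ~ F x -> F (x ~> a).
  move=> Fx; apply: contrapT => Fxa; apply: Fx.
  apply: (maxF _ (deductive_adjoin x dF)) => //= z Fz.
  exact: deductive_ile (imp_weaken z x) Fz.
have FM x y : `[< F (x ~> y) >] = (`[< F x >] ==> `[< F y >]).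
  apply/asboolP/implyP => [Fxy /asboolP Fx|Fxy].
    by apply/asboolP; apply: FMP Fx Fxy.
  have [Fx|/notF Fxa] := pselect (F x).
    apply: deductive_ile (imp_weaken y x) _ => //.
    by apply/asboolP/Fxy/asboolP.
  apply: contrapT => /notF Fxya; apply: Fa; apply: FMP Fxa _.
  exact: deductive_ile (imp_case_split x y a) Fxya.
by exists (Valuation FM); apply/asboolP.
Qed.

Lemma ileP x y : ile x y <-> forall v : valuation A, v x -> v y.
Proof.
split=> [xy v vx|xy].
  by have := valuation_imp v x y; rewrite xy valuation_imp vx => /esym/implyP->.
apply: contrapT => nxy; have [|v] := @valuation_separates (x ~> y).
  by exists x.
by rewrite valuation_imp (introT implyP (xy v)).
Qed.

Lemma valuation_inj x y : (forall v : valuation A, v x = v y) -> x = y.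
Proof. by move=> xy; apply: ile_antisym; apply/ileP => v; rewrite xy. Qed.

(** The meet of x and y in the Boolean algebra [l, 1], by De Morgan's law:
    x ~> y ~> l is the join of the complements of x and y. *)
Definition meet_above l x y := (x ~> y ~> l) ~> l.

Lemma valuation_meet_above (v : valuation A) l x y :
  (v l -> v x && v y) -> v (meet_above l x y) = v x && v y.
Proof.
rewrite !valuation_imp.
by case: (v l) => [/(_ isT)/andP[-> ->]|] //; case: (v x); case: (v y).
Qed.

(** If z is the meet of x and y, then their meet in [z, 1] is a lower bound of
    both, so it equals z; and meets in [z, 1] are pointwise. *)
Lemma is_meetP x y z :
  is_meet x y z <-> forall v : valuation A, v z = v x && v y.
Proof.
split=> [[/ileP zx /ileP zy zmax] v|zE].
  have vm (w : valuation A) : w (meet_above z x y) = w x && w y.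
    by apply: valuation_meet_above => wz; rewrite zx // zy.
  have /ileP mz : ile (meet_above z x y) z.
    by apply: zmax; apply/ileP => w; rewrite vm => /andP[].
  apply/idP/idP => [vz|]; first by rewrite zx // zy.
  by rewrite -vm; apply: mz.
split; first by apply/ileP => v; rewrite zE => /andP[].
  by apply/ileP => v; rewrite zE => /andP[].
move=> w /ileP wx /ileP wy; apply/ileP => v vw.
by rewrite zE wx // wy.
Qed.

End Separation.

Lemma morphism_meet (A B : implicationAlgebraType) (f : A -> B)
    (fM : forall x y, f (x ~> y) = f x ~> f y) x y z :
  is_meet x y z -> is_meet (f x) (f y) (f z).
Proof.
by move=> /is_meetP zE; apply/is_meetP => v; apply: (zE (valuation_comp fM v)).
Qed.

(** * The envelope *)

Section Envelope.
Variable L : symmetricImplicationAlgebraType.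
Implicit Types (v : valuation L) (x y u l : L) (phi psi : valuation L -> bool).

Definition valuationT v : valuation L := valuation_comp (@symT_imp L) v.

Lemma valuationTK : involutive valuationT.
Proof. by move=> v; apply: valuation_ext => x /=; rewrite symTK. Qed.

Definition enveloped phi : Prop := exists l p q,
  [/\ forall v, v l -> v p && v q, forall v, v p || v q
    & forall v, phi v = v p && v (symT q)].

(** The witness x is p, and y is the meet of p and q: since p and q have join 1,
    q is the complement p ~> y of p in [y, 1]. *)
Lemma enveloped_delta phi : enveloped phi ->
  exists x y, ile y x /\ forall v, phi v = v x && v (symT (x ~> y)).
Proof.
move=> [l [p [q [lpq pq phiE]]]]; exists p, (meet_above l p q).
have mE v := valuation_meet_above (lpq v).
split=> [|v]; first by apply/ileP => v; rewrite mE => /andP[].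
rewrite phiE; congr (_ && v (symT _)); apply: valuation_inj => w.
by rewrite valuation_imp mE; have := pq w; case: (w p); case: (w q).
Qed.

Lemma enveloped_imp phi psi : enveloped phi -> enveloped psi ->
  enveloped (fun v => phi v ==> psi v).
Proof.
move=> [l [p [q [_ _ phiE]]]] [m [r [s [mrs rs psiE]]]].
exists m, (p ~> symT q ~> r), (symT p ~> q ~> s); split=> v.
- by move=> /mrs/andP[vr vs]; rewrite !valuation_imp vr vs !implybT.
- by rewrite !valuation_imp; have := rs v; case: (v r) => /= [_|->];
    rewrite !implybT ?orbT.
- rewrite phiE psiE !symT_imp symTK !valuation_imp.
  by case: (v p); case: (v (symT q)).
Qed.

Lemma enveloped_symT phi : enveloped phi ->
  enveloped (fun v => phi (valuationT v)).
Proof.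
move=> [l [p [q [lpq pq phiE]]]]; exists l, q, p; split=> v.
- by rewrite andbC; apply: lpq.
- by rewrite orbC; apply: pq.
- by rewrite phiE /= symTK andbC.
Qed.

Lemma enveloped_eval x : enveloped (fun v => v x).
Proof.
exists x, x, (x ~> x); split=> v; rewrite ?symT_imp valuation_imp;
  by rewrite implybb ?andbT ?orbT.
Qed.

(** Let phi = p /\ T q lie above psi = r /\ T s, and put w = phi ~> psi.
    Distributivity splits any z above psi as z = (z \/ r) /\ T (T z \/ s).
    Splitting both phi and w gives

      phi /\ T w = P /\ T Q
      with P = (phi \/ r) /\ (T w \/ s) and Q = (T phi \/ s) /\ (w \/ r).

    All four factors lie in L, as joins of elements of L with r or s; they are
    above the common lower bound l of r and s, so P and Q are in L and above l.
    The join of P and Q is 1, because phi \/ w = 1 and r \/ s = 1. *)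
Lemma enveloped_caret phi psi : enveloped phi -> enveloped psi ->
  (forall v, psi v -> phi v) ->
  enveloped (fun v => phi v && (phi (valuationT v) ==> psi (valuationT v))).
Proof.
move=> [k [p [q [_ _ phiE]]]] [l [r [s [lrs rs psiE]]]] le.
pose join x y := (x ~> y) ~> y.
(* As psi <= r, w \/ r is phi ~> r = p ~> T q ~> r; the factor T w \/ s is
   dual. *)
pose P := meet_above l (meet_above l (join p r) (join (symT q) r))
  (symT p ~> q ~> s).
pose Q := meet_above l (meet_above l (join (symT p) s) (join q s))
  (p ~> symT q ~> r).
have PE v : v P = [&& v p || v r, v (symT q) || v r
                    & v (symT p) ==> v q ==> v s].
  rewrite /P /meet_above /join !valuation_imp; have := lrs v.
  by case: (v l) => [/(_ isT)/andP[-> ->]|_]; case: (v p); case: (v r);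
    case: (v (symT q)); case: (v (symT p)); case: (v q); case: (v s).
have QE v : v Q = [&& v (symT p) || v s, v q || v s
                    & v p ==> v (symT q) ==> v r].
  rewrite /Q /meet_above /join !valuation_imp; have := lrs v.
  by case: (v l) => [/(_ isT)/andP[-> ->]|_]; case: (v p); case: (v r);
    case: (v (symT q)); case: (v (symT p)); case: (v q); case: (v s).
exists l, P, Q; split=> v.
- by rewrite PE QE => /lrs/andP[-> ->]; rewrite !implybT !orbT.
- have := rs v; rewrite PE QE.
  by case: (v r); case: (v s); case: (v p); case: (v q);
    case: (v (symT p)); case: (v (symT q)).
- have := rs v; have := rs (valuationT v); have := le v;
    have := le (valuationT v).
  have := QE (valuationT v); rewrite PE /= => ->.
  rewrite !phiE !psiE /= !symTK.
  by case: (v p); case: (v q); case: (v (symT p)); case: (v (symT q));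
    case: (v r); case: (v s); case: (v (symT r)); case: (v (symT s)) => //=;
    do ?[case/(_ isT) | move=> _].
Qed.

Definition envelope := {phi : valuation L -> bool | enveloped phi}.

Lemma envelope_ext (a b : envelope) : sval a =1 sval b -> a = b.
Proof.
case: a b => [phi ph] [psi ps] /= /funext e; rewrite e in ph *.
by congr exist; apply: Prop_irrelevance.
Qed.

Definition env_imp (a b : envelope) : envelope :=
  exist enveloped _ (enveloped_imp (svalP a) (svalP b)).

Definition env_symT (a : envelope) : envelope :=
  exist enveloped _ (enveloped_symT (svalP a)).

Definition env_eval x : envelope := exist enveloped _ (enveloped_eval x).

Fact env_imp_contract a b : env_imp (env_imp a b) a = a.
Proof.
by apply: envelope_ext => v /=; case: (sval a v); case: (sval b v).
Qed.

Fact env_imp_quasicomm a b :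
  env_imp (env_imp a b) b = env_imp (env_imp b a) a.
Proof.
by apply: envelope_ext => v /=; case: (sval a v); case: (sval b v).
Qed.

Fact env_imp_exchange a b c :
  env_imp a (env_imp b c) = env_imp b (env_imp a c).
Proof.
by apply: envelope_ext => v /=; case: (sval a v); case: (sval b v).
Qed.

HB.instance Definition _ := isImplicationAlgebra.Build envelope
  env_imp_contract env_imp_quasicomm env_imp_exchange.

Fact env_symT_imp (a b : envelope) :
  env_symT (a ~> b) = env_symT a ~> env_symT b.
Proof. exact: envelope_ext. Qed.

Fact env_symTK : involutive env_symT.
Proof. by move=> a; apply: envelope_ext => v /=; rewrite valuationTK. Qed.

HB.instance Definition _ := isSymmetric.Build envelope env_symT_imp env_symTK.

Lemma env_ileP (a b : envelope) :
  ile a b <-> forall v, sval a v -> sval b v.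
Proof.
split=> [ab v av|ab].
  have := congr1 (fun c : envelope => sval c v) ab.
  by rewrite /= av implybT.
apply: envelope_ext => v /=; rewrite implybb; apply/implyP/ab.
Qed.

Lemma env_is_meet (a b c : envelope) :
  (forall v, sval c v = sval a v && sval b v) -> is_meet a b c.
Proof.
move=> cE; split; try by apply/env_ileP => v; rewrite cE => /andP[].
move=> d /env_ileP da /env_ileP db; apply/env_ileP => v dv.
by rewrite cE da // db.
Qed.

Fact env_caret_exists (a b : envelope) :
  ile b a -> exists c : envelope, is_caret a b c.
Proof.
move=> /env_ileP ba.
exists (exist enveloped _ (enveloped_caret (svalP a) (svalP b) ba)).
exact: env_is_meet.
Qed.

HB.instance Definition _ := isLocallySymmetric.Build envelope env_caret_exists.

Lemma env_eval_embedding : symmetric_embedding env_eval.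
Proof.
split; last first.
  move=> x y xy; apply: valuation_inj => v.
  exact: (congr1 (fun c : envelope => sval c v) xy).
split=> [x y|x]; apply: envelope_ext => v //=; exact: valuation_imp.
Qed.

(** If p /\ T q lies above an element x of L, then x is a lower bound of p and
    T q, so their meet is already in L. *)
Lemma env_eval_upclosed : range_upclosed env_eval.
Proof.
move=> x b /env_ileP xb; have [l [p [q [_ _ bE]]]] := svalP b.
exists (meet_above x p (symT q)); apply: envelope_ext => v /=.
by rewrite bE valuation_meet_above // -bE; apply: xb.
Qed.

Lemma env_delta (b : envelope) : exists x y, ile y x /\
  forall v, sval b v = v x && v (symT (x ~> y)).
Proof. exact: enveloped_delta (svalP b). Qed.

Lemma env_eval_generates : range_generates env_eval.
Proof.
move=> S Se _ Scaret b; have [x [y [_ bE]]] := env_delta b.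
apply: (Scaret (env_eval x) (env_eval y) b) => //.
apply: env_is_meet => v.
by rewrite bE /= symT_imp !valuation_imp.
Qed.

(** * The extension of a morphism *)

Section Extension.
Variables (M : locallySymmetricImplicationAlgebraType) (f : L -> M).
Hypothesis fmor : symmetric_morphism f.

Definition pullback : valuation M -> valuation L := valuation_comp fmor.1.

Lemma extension_exists (b : envelope) :
  exists m : M, forall v : valuation M, v m = sval b (pullback v).
Proof.
have [x [y [yx bE]]] := env_delta b; have [fM fT] := fmor.
have fyx : ile (f y) (f x).
  by apply/ileP => v; apply: (proj1 (ileP y x) yx (pullback v)).
have [m /is_meetP mE] := caret_exists _ _ fyx.
by exists m => v; rewrite mE bE /= fT fM.
Qed.

Definition extension (b : envelope) : M := sval (cid (extension_exists b)).

Lemma extensionE (b : envelope) (v : valuation M) :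
  v (extension b) = sval b (pullback v).
Proof. by rewrite /extension; case: cid. Qed.

Lemma extension_morphism : symmetric_morphism extension.
Proof.
split=> [a b|a]; apply: valuation_inj => v.
  by rewrite valuation_imp !extensionE.
rewrite extensionE /=.
have := extensionE a (valuation_comp (@symT_imp M) v) => /= ->.
by congr (sval a _); apply: valuation_ext => x /=; rewrite fmor.2.
Qed.

Lemma extension_eval x : extension (env_eval x) = f x.
Proof. by apply: valuation_inj => v; rewrite extensionE. Qed.

(** The elements at which g and the extension agree are closed under the
    caret, because both maps preserve existing meets. *)
Lemma extension_unique (g : envelope -> M) : symmetric_morphism g ->
  (forall x, g (env_eval x) = f x) -> forall b, g b = extension b.
Proof.
move=> [gM gT] ge; have [hM hT] := extension_morphism.
apply: env_eval_generates => [x|a b ga gb|a b c ga gb abc].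
- by rewrite ge extension_eval.
- by rewrite gM hM ga gb.
have /is_meetP gc := morphism_meet gM abc.
have /is_meetP hc := morphism_meet hM abc.
by apply: valuation_inj => v; rewrite gc hc gT hT gM hM ga gb.
Qed.

End Extension.

End Envelope.

Theorem theorem5p1 (L : symmetricImplicationAlgebraType) :
  exists (env : locallySymmetricImplicationAlgebraType) (e : L -> env),
    [/\ symmetric_embedding e,
        range_upclosed e /\ range_generates e
      & forall (M : locallySymmetricImplicationAlgebraType) (f : L -> M),
          symmetric_morphism f ->
          exists fhat : env -> M,
            [/\ symmetric_morphism fhat,
                forall x, fhat (e x) = f x
              & forall g : env -> M,
                  symmetric_morphism g -> (forall x, g (e x) = f x) ->
                  forall z, g z = fhat z]].
Proof.
exists (envelope L), (@env_eval L); split.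
- exact: env_eval_embedding.
- by split; [apply: env_eval_upclosed|apply: env_eval_generates].
move=> M f fmor; exists (extension fmor); split.
- exact: extension_morphism.
- exact: extension_eval.
- exact: extension_unique.
Qed.
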